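(* Fix a motif specification on $p,L$ and let $H$ be its hypergraph. Let $\mathcal S\subseteq\mathbb{R}^p$ be a finite set of size $r$. Then $\mathcal M(\mathcal S)\le r^{\tau^*(H)}$.
   Context: Let $L,p$ be positive integers. A motif specification on $p,L$ consists of partitions $\pi_1,\dots,\pi_p$, where each $\pi_m$ is a partition of some subset of $\{1,\dots,L\}$, together with real constants $D_{im}$ for each pair $(i,m)$ with $i\in\{1,\dots,L\}$, $m\in\{1,\dots,p\}$ and $i$ in no block of $\pi_m$. A tuple $(f_1,\dots,f_L)\in(\mathbb{R}^p)^L$ is a motif if (1) whenever $i,j$ lie in the same block of $\pi_m$, $(f_i)_m=(f_j)_m$; and (2) whenever $i$ lies in no block of $\pi_m$, $(f_i)_m=D_{im}$. For $\mathcal S\subseteq\mathbb{R}^p$, $\mathcal M(\mathcal S)$ is the number of $L$-tuples of elements of $\mathcal S$ (repetitions allowed) that are motifs. The hypergraph $H$ of the specification has vertex set $\{1,\dots,L\}$ and one edge for each block of each $\pi_m$, the edge being the set of elements of that block (duplicate edges allowed). A fractional transversal of $H$ is $g:V(H)\to\mathbb{R}_{\ge0}$ with $\sum_{x\in e}g(x)\ge1$ for every edge $e$; $\tau^*(H)$ is the minimum of $\sum_x g(x)$ over fractional transversals. Convention: $0^0=1$. *)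

(* Defs.v *)
From mathcomp Require Import all_boot all_order all_algebra.
From mathcomp Require Import finmap.
From mathcomp Require Import all_classical all_reals all_analysis.

Set Implicit Arguments.
Unset Strict Implicit.
Unset Printing Implicit Defensive.

Import Order.TTheory GRing.Theory Num.Theory.
Import numFieldNormedType.Exports.

Local Open Scope ring_scope.

(** A hypergraph on [V] is the list of its edges, so that duplicate edges are
    allowed. *)
Definition hypergraph (V : finType) := seq {set V}.

Definition fractional_transversal (R : realType) (V : finType)
    (H : hypergraph V) (g : V -> R) : Prop :=
  (forall x, 0 <= g x) /\ (forall e, e \in H -> 1 <= \sum_(x in e) g x).

(** When no edge is empty the infimum is a minimum: see [tau_star_attained]. *)
Definition tau_star (R : realType) (V : finType) (H : hypergraph V) : R :=
  inf [set \sum_x g x | g in @fractional_transversal R V H]%classic.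

(** [spec_const s i m] is the constant D_im.  It is a total function of [(i, m)]
    but [motif] reads it only when [i] is in no block of [spec_part s m]. *)
Record motif_spec (R : realType) (p L : nat) := MotifSpec {
  spec_part : 'I_p -> {set {set 'I_L}};
  spec_partP : forall m,
    finset.partition (spec_part m) (finset.cover (spec_part m));
  spec_const : 'I_L -> 'I_p -> R }.

Definition motif (R : realType) (p L : nat) (s : motif_spec R p L)
    (f : 'I_L -> 'rV[R]_p) : Prop :=
  (forall m B i j, B \in spec_part s m -> i \in B -> j \in B ->
     f i ord0 m = f j ord0 m) /\
  (forall i m, i \notin finset.cover (spec_part s m) ->
     f i ord0 m = spec_const s i m).

Definition motif_count (R : realType) (p L : nat) (s : motif_spec R p L)
    (S : {fset 'rV[R]_p}) : nat :=
  #|[pred t : L.-tuple S | `[< motif s (fun i => val (tnth t i)) >]]|.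

Definition motif_hypergraph (R : realType) (p L : nat)
    (s : motif_spec R p L) : hypergraph 'I_L :=
  [seq B | m <- enum 'I_p, B <- enum (spec_part s m)].

Lemma tau_star_attained (R : realType) (V : finType) (H : hypergraph V) :
  (forall e, e \in H -> e != finset.set0) ->
  exists2 g, fractional_transversal H g &
    tau_star R H = \sum_x g x /\
    forall h, fractional_transversal H h -> \sum_x g x <= \sum_x h x :> R.
Proof.
move=> H0.
pose F (v : 'rV[R]_#|V|) (x : V) := v ord0 (enum_rank x).
have cw (e : {pred V}) : continuous (fun v => \sum_(x in e) F v x).
  apply: continuous_big; first exact: add_continuous.
  by move=> x _; exact: coord_continuous.
pose A : set 'rV[R]_#|V| :=
  ([set v : 'rV[R]_#|V| | forall i, `[0%R, 1%R] (v ord0 i)] `&`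
   \bigcap_(e in [set e | e \in H]) [set v | 1 <= \sum_(x in e) F v x])%classic.
have cA : compact A.
  apply: compact_closedI.
    by apply: (@rV_compact R _ (fun=> `[0%R, 1%R]%classic)) => i;
      exact: segment_compact.
  apply: closed_bigI => e _.
  apply: (@closed_comp _ _ (fun v => \sum_(x in e) F v x) [set y | 1 <= y]%classic).
    by move=> v _; exact: cw.
  exact: closed_ge.
have trunc h : fractional_transversal H h ->
    exists2 v, A v & forall x, F v x <= h x.
  move=> [h0 hH].
  pose v : 'rV[R]_#|V| := \row_i Num.min (h (enum_val i)) 1.
  have Fv x : F v x = Num.min (h x) 1 by rewrite /F mxE enum_rankK.
  exists v; last by move=> x; rewrite Fv ge_min lexx.
  split=> [i|e He] /=.
    by rewrite mxE in_itv /= le_min h0 ler01 ge_min lexx orbT.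
  have v0 x : 0 <= F v x by rewrite Fv le_min h0 ler01.
  have [/existsP[x /andP[xe hx]]|] := boolP [exists x, (x \in e) && (1 <= h x)].
    rewrite (bigD1 x) //= {1}Fv (min_idPr hx) lerDl.
    by apply: sumr_ge0.
  move=> /existsPn hlt; apply: le_trans (hH e He) _.
  apply: ler_sum => x xe; rewrite Fv le_min lexx /=.
  by move: (hlt x); rewrite xe /= -ltNge => /ltW.
have one_tr : fractional_transversal H (fun=> 1 : R).
  split=> // e /H0 /set0Pn[x xe].
  by rewrite (bigD1 x) //= lerDl; apply: sumr_ge0.
have A0 : (A !=set0)%classic by have [v Av _] := trunc _ one_tr; exists v.
have cwA := continuous_subspaceT (A := A) (cw predT).
have [c cinA cmin] := compact_EVT_min A0 cA cwA.
have Ac : A c by move: cinA; rewrite inE.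
have trc : fractional_transversal H (F c).
  case: Ac => c01 cH; split=> [x|e He]; last exact: cH.
  by have := c01 (enum_rank x); rewrite /= in_itv /= => /andP[].
have lec h : fractional_transversal H h -> \sum_x F c x <= \sum_x h x :> R.
  move=> /trunc[v Av vh]; apply: (le_trans (cmin v _)); first by rewrite inE.
  exact: ler_sum.
exists (F c) => //; split=> //; apply/eqP; rewrite eq_le; apply/andP; split.
  apply: ge_inf; last by exists (F c).
  by exists (\sum_x F c x) => _ [h /lec + <-].
by apply: lb_le_inf => [|_ [h /lec + <-] //]; exists (\sum_x F c x), (F c).
Qed.

Lemma motif_hypergraph_edge_neq0 (R : realType) (p L : nat)
    (s : motif_spec R p L) (e : {set 'I_L}) :
  e \in motif_hypergraph s -> e != finset.set0.
Proof.
case/allpairsPdep=> m [B [_]]; rewrite mem_enum => Bm ->.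
by apply/negP => /eqP B0; case/and3P: (spec_partP s m) => _ _ /negP; rewrite -B0.
Qed.

(* Main.v *)
(** Count the tuples one block at a time. Conditioning on the common value of
    the coordinates prescribed by a block replaces the sets from which its
    entries are drawn by their fibres over that value. Given a fractional
    transversal [g], the bound [\prod_i #|A i| `^ g i] survives the sum over
    the values by Hoelder's inequality, as the weights on each block sum to at
    least [1]. When all blocks are used up each set has at most one element.
    An optimal [g] gives the exponent [tau_star]. *)

Require Import Defs.
From mathcomp Require Import all_boot all_order all_algebra.
From mathcomp Require Import finmap.
From mathcomp Require Import all_classical all_reals all_analysis.

Import Order.TTheory GRing.Theory Num.Theory.

Local Open Scope ring_scope.

Lemma prod_powR_cst (R : realType) (I : finType) (P : pred I) (g : I -> R)
    (a : R) :
  0 < a -> \prod_(i | P i) a `^ g i = a `^ (\sum_(i | P i) g i).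
Proof.
move=> a0; elim/big_rec2: _ => [|i x y _ ->]; first by rewrite powRr0.
by rewrite powRD// (gt_eqF a0) implybT.
Qed.

(* Summing [ln y <= y - 1] at [y = x i / q] with weights [g i], where [q] is
   the weighted mean, makes the right-hand sides cancel. *)
Lemma weighted_amgm (R : realType) (I : finType) (P : pred I) (g x : I -> R) :
  (forall i, 0 <= g i) -> (forall i, 0 <= x i) -> 0 < \sum_(i | P i) g i ->
  \prod_(i | P i) x i `^ g i <=
  ((\sum_(i | P i) g i * x i) / \sum_(i | P i) g i) `^ (\sum_(i | P i) g i).
Proof.
move=> g0 x0; set G := \sum_(i | P i) g i => G0.
have gx0 i : P i -> 0 <= g i * x i by rewrite mulr_ge0.
(* A zero mean cannot be divided by. In that case some [x i] of nonzero weight vanishes, and the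
   left side is 0. *)
have [s0|sN0] := eqVneq (\sum_(i | P i) g i * x i) 0.
  have /existsP[i /andP[Pi gi]] : [exists i, P i && (g i != 0)].
    apply: contraT; rewrite negb_exists => /forallP gz.
    move: G0; rewrite /G big1 ?ltxx// => i Pi.
    by apply/eqP; have := gz i; rewrite Pi negbK.
  have : g i * x i == 0 by rewrite (psumr_eq0P gx0 s0).
  rewrite mulf_eq0 (negPf gi) /= => /eqP xi0.
  by rewrite (bigD1 i)//= xi0 powR0// mul0r powR_ge0.
set q := _ / G; have q0 : 0 < q by rewrite divr_gt0// lt_def sN0 sumr_ge0.
pose F i := q `^ g i * expR (g i * (x i / q - 1)).
apply: (@le_trans _ _ (\prod_(i | P i) F i)).
  apply: ler_prod => i _; rewrite powR_ge0 /F /=.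
  have y0 : 0 <= x i / q by rewrite divr_ge0 ?(ltW q0).
  rewrite -[x i in leLHS](divfK (lt0r_neq0 q0)) mulrC powRM ?(ltW q0)//.
  rewrite ler_wpM2l ?powR_ge0// [g i * _]mulrC expRM.
  apply: ge0_ler_powR; rewrite ?nnegrE ?expR_ge0//.
  by rewrite (le_trans _ (expR_ge1Dx _))// addrC subrK.
rewrite big_split/= prod_powR_cst// -expR_sum.
have -> : \sum_(i | P i) g i * (x i / q - 1) = 0.
  under eq_bigr do rewrite mulrBr mulr1 mulrA.
  rewrite sumrB -mulr_suml -/G /q invf_div mulrCA divff// mulr1 subrr//.
by rewrite expR0 mulr1.
Qed.

(** Divide each [a i] by its total [A i]. By weighted AM-GM the normalised product at [v] is at most
    [q v] to the power [G], hence at most [q v], and the [q v] sum to at most 1. *)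
Lemma generalized_hoelder (R : realType) (I V : finType) (P : pred I)
    (g : I -> R) (a : I -> V -> R) :
  (forall i, 0 <= g i) -> 1 <= \sum_(i | P i) g i ->
  (forall i v, 0 <= a i v) ->
  \sum_v \prod_(i | P i) a i v `^ g i <=
  \prod_(i | P i) (\sum_v a i v) `^ g i.
Proof.
move=> g0 G1 a0; set G := \sum_(i | P i) g i in G1.
have G0 : 0 < G by apply: lt_le_trans G1.
pose A i := \sum_v a i v.
have A0 i : 0 <= A i by apply: sumr_ge0.
have aA i v : a i v <= A i by rewrite /A (bigD1 v)//= lerDl sumr_ge0.
(* If [A i] is 0, so is every [a i v], and the quotient is 0 by the convention for inverses. *)
have aE i v : a i v = A i * (a i v / A i).
  have [Ai0|?] := eqVneq (A i) 0; last by rewrite mulrC divfK.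
  by apply/eqP; rewrite Ai0 mul0r eq_le a0 -Ai0 aA.
have p01 i v : 0 <= a i v / A i <= 1.
  rewrite divr_ge0//=; have [->|Ai0] := eqVneq (A i) 0.
    by rewrite invr0 mulr0 ler01.
  by rewrite ler_pdivrMr ?mul1r// lt_def Ai0 A0.
pose q v := (\sum_(i | P i) g i * (a i v / A i)) / G.
have q01 v : 0 <= q v <= 1.
  apply/andP; split.
    apply: divr_ge0 (ltW G0); apply: sumr_ge0 => i _.
    by rewrite mulr_ge0// divr_ge0.
  rewrite ler_pdivrMr// mul1r; apply: ler_sum => i _.
  by rewrite ler_piMr//; case/andP: (p01 i v).
apply: (@le_trans _ _ (\sum_v (\prod_(i | P i) A i `^ g i) * q v)).
  apply: ler_sum => v _.
  under eq_bigr => i _.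
    rewrite aE powRM//; last by case/andP: (p01 i v).
    over.
  rewrite big_split/= ler_wpM2l ?prodr_ge0// => [i _|]; first exact: powR_ge0.
  apply: le_trans (weighted_amgm _ _ _ _ _ g0 _ G0) _ => [i|].
    by case/andP: (p01 i v).
  rewrite -/G -/(q v); have [->|qv0] := eqVneq (q v) 0.
    by rewrite powR0 ?gt_eqF.
  (* Total weight at least 1 is used here: a power [G >= 1] does not increase a number in (0, 1]. *)
  by apply: ge1r_powR G1; case/andP: (q01 v) => ? ->; rewrite lt_def qv0 andbT.
rewrite -mulr_sumr ler_piMr ?prodr_ge0// => [i _|]; first exact: powR_ge0.
rewrite -mulr_suml exchange_big/= ler_pdivrMr// mul1r ler_sum// => i _.
rewrite -mulr_sumr -mulr_suml ler_piMr//.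
have [Ai0|Ai0] := eqVneq (A i) 0; first by rewrite Ai0 invr0 mulr0 ler01.
by rewrite divff.
Qed.

Lemma sum_card_fiber (T V : finType) (X : {set T}) (h : T -> V) :
  (\sum_v #|[set x in X | h x == v]| = #|X|)%N.
Proof.
rewrite -[RHS]sum1_card (partition_big h predT)//=.
by apply: eq_bigr => v _; rewrite -sum1dep_card.
Qed.

(** A pair [(B, h)] in [l] forces [h] to be constant on the entries indexed by [B]. A list of
    constraints and a separate domain for each entry allow induction over blocks. *)
Definition constrained_tuples (T V : finType) (L : nat)
    (l : seq ({set 'I_L} * {ffun T -> V})) (A : 'I_L -> {set T}) :
    {set L.-tuple T} :=
  [set t : L.-tuple T | [forall i, tnth t i \in A i] &&
    all (fun c : {set _} * {ffun T -> V} => [forall i in c.1, forall j in c.1,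
                     c.2 (tnth t i) == c.2 (tnth t j)]) l].

Arguments constrained_tuples {T V L} l A.

(** The last hypothesis says that the constraints on entry [i] separate the points of [A i]. It
    survives the removal of [(B, h)], since [h] is constant on the fibres that replace the
    domains. *)
Lemma card_constrained_tuples (R : realType) (T V : finType) (L : nat)
    (g : 'I_L -> R) (l : seq ({set 'I_L} * {ffun T -> V}))
    (A : 'I_L -> {set T}) :
  (forall i, 0 <= g i) ->
  (forall c, c \in l -> 1 <= \sum_(i in c.1) g i) ->
  (forall i x y, x \in A i -> y \in A i ->
    (forall c, c \in l -> i \in c.1 -> c.2 x = c.2 y) -> x = y) ->
  #|constrained_tuples l A|%:R <= \prod_i #|A i|%:R `^ g i.
Proof.
move=> g0; elim: l A => [|[B h] l IH] A gl sepA.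
  set X := constrained_tuples _ _.
  have At u i : u \in X -> tnth u i \in A i by rewrite inE andbT => /forallP.
  have [->|[t tP]] := finset.set_0Vmem X.
    by rewrite cards0; apply: prodr_ge0 => i _; exact: powR_ge0.
  have -> : X = [set t]%SET.
    apply/setP => u; rewrite [RHS]inE; apply/idP/eqP => [uP|->//].
    by apply: eq_from_tnth => i; apply: (sepA i); rewrite ?At.
  rewrite cards1 big1// => i _.
  suff -> : A i = [set tnth t i]%SET by rewrite cards1 powR1.
  apply/setP => x; rewrite inE; apply/idP/eqP => [xA|->]; last exact: At.
  by apply: (sepA i); rewrite ?At.
have gB : 1 <= \sum_(i in B) g i by apply: (gl (B, h)); rewrite mem_head.
(* The entry at [i0] serves to read off the common value of [h] on [B]. *)
have /existsP[i0 i0B] : [exists i, i \in B].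
  apply: contraTT gB; rewrite negb_exists => /forallP B0.
  by rewrite big_pred0 ?ler10// => i; apply/negbTE.
pose fib v i := if i \in B then [set x in A i | h x == v]%SET else A i.
have fibS v i x : x \in fib v i -> x \in A i.
  by rewrite /fib; case: ifP; rewrite ?inE => // _ /andP[].
apply: (@le_trans _ _ (\sum_v #|constrained_tuples l (fib v)|%:R)).
  rewrite -(sum_card_fiber _ _ _ (fun t => h (tnth t i0))) natr_sum.
  apply: ler_sum => v _; rewrite ler_nat; apply/subset_leq_card/fintype.subsetP.
  move=> t; rewrite !inE /= => /andP[/and3P[/forallP tA /forall_inP tB ->]].
  move=> /eqP tv; rewrite andbT; apply/forallP => i; rewrite /fib.
  case: ifP => // iB; rewrite inE tA -tv /=.
  by have /forall_inP := tB i iB; apply.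
apply: (@le_trans _ _ (\sum_v \prod_i #|fib v i|%:R `^ g i)).
  apply: ler_sum => v _; apply: IH => [c cl|i x y xv yv xy].
    by apply: gl; rewrite inE cl orbT.
  apply: (sepA i); [exact: fibS xv|exact: fibS yv|] => c.
  rewrite inE => /predU1P[-> /= iB|]; last exact: xy.
  by move: xv yv; rewrite /fib iB !inE => /andP[_ /eqP->] /andP[_ /eqP->].
have splitB v : \prod_i #|fib v i|%:R `^ g i =
    (\prod_(i in B) #|[set x in A i | h x == v]%SET|%:R `^ g i) *
    \prod_(i | i \notin B) #|A i|%:R `^ g i.
  rewrite (bigID (mem B))/=; congr (_ * _); apply: eq_bigr => i.
    by move=> iB; rewrite /fib iB.
  by move=> /negbTE iB; rewrite /fib iB.
rewrite (eq_bigr _ (fun v _ => splitB v)) -mulr_suml.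
rewrite [leRHS](bigID (mem B))/= ler_wpM2r//.
  by apply: prodr_ge0 => i _; exact: powR_ge0.
(* For fixed [i] the fibre sizes sum to the size of [A i], so Hoelder restores the factors over
   [B]. *)
pose a i v : R := #|[set x in A i | h x == v]%SET|%:R.
apply: le_trans (generalized_hoelder _ _ _ _ _ a g0 gB _) _.
  by move=> i v; exact: ler0n.
apply: ler_prod => i iB; rewrite powR_ge0/= -natr_sum sum_card_fiber//.
Qed.

Theorem theorem2 (R : realType) (p L : nat) (hp : (0 < p)%N) (hL : (0 < L)%N)
    (s : motif_spec R p L) (S : {fset 'rV[R]_p}) (r : nat)
    (hS : #|` S|%fset = r) :
  (motif_count s S)%:R <= r%:R `^ tau_star R (motif_hypergraph s).
Proof.
have [g [g0 gH] [-> _]] :=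
  tau_star_attained R (@motif_hypergraph_edge_neq0 _ _ _ s).
(* Constraint values must lie in a finite type, so the real coordinate [m] of [x] is encoded as the
   set of points of [S] that share it. *)
pose coord (m : 'I_p) : {ffun S -> {set S}} :=
  [ffun x : S => [set y : S | val y ord0 m == val x ord0 m]%SET].
have coordP m x y : coord m x = coord m y <-> val x ord0 m = val y ord0 m.
  split=> [/setP/(_ x)|xy]; first by rewrite !ffunE !inE eqxx => /esym/eqP.
  by rewrite !ffunE xy.
pose l : seq ({set 'I_L} * {ffun S -> {set S}}) :=
  [seq (B, coord m) | m <- enum 'I_p, B <- enum (spec_part s m)].
pose A i : {set S} := [set x : S | [forall m,
  (i \notin finset.cover (spec_part s m)) ==>
  (val x ord0 m == spec_const s i m)]]%SET.
have count_le : (motif_count s S <= #|constrained_tuples l A|)%N.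
  apply/subset_leq_card/fintype.subsetP => t; rewrite inE => -[tB tD].
  rewrite [_ \in _]finset.inE.
  apply/andP; split.
    apply/forallP => i; rewrite inE; apply/forallP => m; apply/implyP => im.
    by apply/eqP; exact: tD.
  apply/allP => _ /allpairsPdep[m [B [_ Bm ->]]] /=.
  apply/forall_inP => i iB; apply/forall_inP => j jB; apply/eqP/coordP.
  by apply: (tB m B); rewrite -?[_ \in spec_part s m]mem_enum.
(* For [r = 0] there are no tuples, as [L] is positive; the final product formula needs a positive
   base. *)
have [r0|rN0] := eqVneq r 0%N.
  suff -> : motif_count s S = 0%N by exact: powR_ge0.
  apply/eqP; rewrite -leqn0 (leq_trans (max_card _))// card_tuple -cardfE hS r0.
  by rewrite exp0n.
have Ar i : (#|A i| <= r)%N by rewrite -hS cardfE max_card.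
apply: (@le_trans _ _ (\prod_i #|A i|%:R `^ g i)).
  apply: le_trans (card_constrained_tuples _ _ _ _ g l A g0 _ _).
  - by rewrite ler_nat.
  - move=> _ /allpairsPdep[m [B [mp Bm ->]]] /=; apply: gH.
    by apply/allpairsPdep; exists m, B.
  (* Separation: each coordinate is fixed by a block containing [i] or by the prescribed
     constant. *)
  move=> i x y; rewrite !inE => /forallP xD /forallP yD xy.
  apply/val_inj/rowP => m; have := xD m; have := yD m.
  have [/bigcupP[B Bm iB] _ _|_ /eqP -> /eqP ->//] :=
    boolP (i \in finset.cover _).
  apply/coordP/(xy (B, coord m)) => //.
  by apply/allpairsPdep; exists m, B; rewrite !mem_enum.
rewrite -prod_powR_cst ?ltr0n ?lt0n//; apply: ler_prod => i _.
by rewrite powR_ge0 /= ge0_ler_powR ?nnegrE// ler_nat.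
Qed.
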